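(* Let $r$ be an integer with $1\le r\le 3$, and let $m,n$ be positive integers. Let $K_{m,n}$ be the complete bipartite graph with partite classes $X$ and $Y$, $|X|=m$, $|Y|=n$. Then in every coloring of the edges of $K_{m,n}$ with $r$ colors there is a monochromatic component $H$ such that $|V(H)\cap X|\ge m/r$ and $|V(H)\cap Y|\ge n/r$.
   Context: An $r$-coloring of the edges of a graph assigns to each edge one of $r$ colors (no properness condition). A monochromatic component of color $i$ is a connected component of the spanning subgraph whose edges are exactly the edges of color $i$. *)

(* Defs.v *)
From mathcomp Require Import all_boot all_order all_algebra.

Set Implicit Arguments.
Unset Strict Implicit.
Unset Printing Implicit Defensive.

(* A simple graph on [V] is given by its (symmetric, irreflexive) adjacency
   relation; an edge is the unordered pair of its end-vertices. *)
Definition edge_set (V : finType) (e : rel V) : {set {set V}} :=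
  [set [set p.1; p.2] | p : V * V & e p.1 p.2].

Definition edge_coloring (V : finType) (e : rel V) (r : nat) : Type :=
  {E : {set V} | E \in edge_set e} -> 'I_r.

(* Adjacency relation, on all of [V], of the spanning subgraph whose edges are
   exactly the edges of colour [i]. *)
Definition color_adj (V : finType) (e : rel V) (r : nat)
    (c : edge_coloring e r) (i : 'I_r) : rel V :=
  fun u v => [exists E : {E : {set V} | E \in edge_set e},
                (val E == [set u; v]) && (c E == i)].

(* [H] is the vertex set of a connected component of the graph [e]. *)
Definition is_component (V : finType) (e : rel V) (H : {set V}) : Prop :=
  exists v : V, H = [set w | connect e v w].

Definition Kmn (X Y : finType) : rel (X + Y) :=
  fun u v => match u, v with
             | inl _, inr _ | inr _, inl _ => true
             | _, _ => false
             end.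
Arguments Kmn : clear implicits.

Definition classX (X Y : finType) : {set X + Y} := [set inl x | x : X].
Arguments classX : clear implicits.

Definition classY (X Y : finType) : {set X + Y} := [set inr y | y : Y].
Arguments classY : clear implicits.

(* Main.v *)
(* Suppose that every monochromatic component is small on the X side or on the
   Y side.  Let S(x) be the set of colors i for which the color-i component of x
   is small on the X side, and U(y) the set of those for which the color-i
   component of y is small on the Y side.  The color of an edge xy lies in exactly
   one of S(x) and U(y); hence S(x) <> U(y), and all these sets are nonempty.
   Counting edges shows that the averages of |S| and |U| add up to less than r,
   so r = 3 and there are vertices with S(x) = {a} and U(y) = {b}, a <> b.  By
   symmetry no y has U(y) = {c}.  Two cases remain, according to whether some
   x has S(x) = {c}.  In both, the main tool is that two vertices y, y' with
   U(y) = U(y') = {b} in different color-b components are also in different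
   components of each of the two other colors. *)
Require Import Defs.
From mathcomp Require Import all_boot all_order all_algebra.
From mathcomp Require Import zify.
Import Order.TTheory GRing.Theory Num.Theory.

Set Implicit Arguments.
Unset Strict Implicit.
Unset Printing Implicit Defensive.

Lemma card_sub2 (T : finType) (A B D : {set T}) :
  A \subset B :|: D -> #|A| <= #|B| + #|D|.
Proof.
by move=> /subset_leq_card /leq_trans; apply; rewrite cardsU leq_subr.
Qed.

Lemma card_sub3 (T : finType) (A B D E : {set T}) :
  A \subset B :|: D :|: E -> #|A| <= #|B| + #|D| + #|E|.
Proof.
move=> /card_sub2 /leq_trans; apply; rewrite leq_add2r.
exact: card_sub2.
Qed.

(* [f i x] and [g i y] name the color-[i] components of [x] and [y]; [sx i t]
   marks those components that are small on the [X] side. *)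
Record bad (C X Y T : finType) (f : C -> X -> T) (g : C -> Y -> T)
    (sx sy : C -> T -> bool) : Prop := Bad {
  bad_cover : forall x y, exists i, f i x = g i y;
  bad_negb : forall i t, sy i t = ~~ sx i t;
  bad_smallX : forall i t, sx i t -> #|C| * #|[set x | f i x == t]| < #|X|;
  bad_smallY : forall i t, sy i t -> #|C| * #|[set y | g i y == t]| < #|Y| }.

Lemma bad_sym (C X Y T : finType) (f : C -> X -> T) (g : C -> Y -> T) sx sy :
  bad f g sx sy -> bad g f sy sx.
Proof.
case=> cov neg smX smY; split=> // [y x|i t]; last by rewrite neg negbK.
by have [i ?] := cov x y; exists i.
Qed.

(** * Counting arguments valid for any number of colors *)

Section AnyNumberOfColors.
Variables (C X Y T : finType) (f : C -> X -> T) (g : C -> Y -> T).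
Variables (sx sy : C -> T -> bool).
Hypothesis B : bad f g sx sy.

(** Otherwise all components of [x] are small on the Y side and together hold fewer than |Y|
    vertices of Y; yet they cover Y. *)
Lemma bad_small_color (x : X) (y : Y) : exists i, sx i (f i x).
Proof.
apply/existsP/contraT; rewrite negb_exists => /forallP nsx.
have lt i : #|C| * #|[set z | g i z == f i x]| <= #|Y|.-1.
  have := bad_smallY B (i := i) (t := f i x); rewrite (bad_negb B) nsx => /(_ isT).
  by lia.
have C0 : 0 < #|C| by have [i _] := bad_cover B x y; apply/card_gt0P; exists i.
have Y0 : 0 < #|Y| by apply/card_gt0P; exists y.
have : #|Y| <= \sum_i #|[set z | g i z == f i x]|.
  rewrite -sum1_card (eq_bigr (fun i => \sum_(z | g i z == f i x) 1)).
    rewrite (exchange_big_dep predT) //=; apply: leq_sum => z _.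
    have [i e] := bad_cover B x z.
    by rewrite (bigD1 i) ?e ?eqxx.
  by move=> i _; rewrite sum1dep_card.
move=> le; have : #|C| * #|Y| <= \sum_(i : C) #|Y|.-1.
  apply: leq_trans (leq_mul (leqnn _) le) _.
  by rewrite big_distrr; apply: leq_sum => i _; apply: lt.
rewrite sum_nat_const leq_mul2l; lia.
Qed.

(* The edges of an [X]-small (resp. [Y]-small) component are charged to their
   ends in [Y] (resp. [X]). *)
Lemma bad_weight (x0 : X) (y0 : Y) :
  #|Y| * (\sum_x \sum_i sx i (f i x)) + #|X| * (\sum_y \sum_i sy i (g i y))
  < #|C| * #|X| * #|Y|.
Proof.
have C0 : 0 < #|C| by have [i _] := bad_cover B x0 y0; apply/card_gt0P; exists i.
have Y0 : 0 < #|Y| by apply/card_gt0P; exists y0.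
have X0 : 0 < #|X| by apply/card_gt0P; exists x0.
(* [P] and [Q] add up the sizes of the complements of the sets U(y) and S(x): they count the
   vertex-color pairs to which edges are charged. *)
pose P := \sum_y \sum_i (sx i (g i y) : nat).
pose Q := \sum_x \sum_i (sy i (f i x) : nat).
have eP : P + \sum_y \sum_i (sy i (g i y) : nat) = #|Y| * #|C|.
  rewrite -big_split -sum_nat_const; apply: eq_bigr => y _ /=.
  rewrite -big_split -sum1_card; apply: eq_bigr => i _ /=.
  by rewrite (bad_negb B); case: (sx _ _).
have eQ : Q + \sum_x \sum_i (sx i (f i x) : nat) = #|X| * #|C|.
  rewrite -big_split -sum_nat_const; apply: eq_bigr => x _ /=.
  rewrite -big_split -sum1_card; apply: eq_bigr => i _ /=.
  by rewrite (bad_negb B); case: (sx _ _).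
have le : #|X| * #|Y| <=
    \sum_y \sum_i sx i (g i y) * #|[set x | f i x == g i y]|
    + \sum_x \sum_i sy i (f i x) * #|[set y | g i y == f i x]|.
  pose E x y i := (f i x == g i y : nat).
  have -> : \sum_y \sum_i sx i (g i y) * #|[set x | f i x == g i y]| =
      \sum_x \sum_y \sum_i sx i (g i y) * E x y i.
    rewrite [RHS]exchange_big; apply: eq_bigr => y _ /=.
    rewrite [RHS]exchange_big; apply: eq_bigr => i _ /=.
    by rewrite -big_distrr -sum1dep_card big_mkcond.
  have -> : \sum_x \sum_i sy i (f i x) * #|[set y | g i y == f i x]| =
      \sum_x \sum_y \sum_i sy i (f i x) * E x y i.
    apply: eq_bigr => x _.
    rewrite [RHS]exchange_big; apply: eq_bigr => i _ /=.
    rewrite -big_distrr -sum1dep_card big_mkcond /=; congr (_ * _).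
    by apply: eq_bigr => y _; rewrite eq_sym.
  rewrite -big_split -sum_nat_const; apply: leq_sum => x _ /=.
  rewrite -big_split -sum1_card; apply: leq_sum => y _ /=.
  rewrite -big_split; have [i e] := bad_cover B x y.
  by rewrite (bigD1 i) //= /E e eqxx (bad_negb B); case: (sx _ _).
have leP : #|C| * (\sum_y \sum_i sx i (g i y) * #|[set x | f i x == g i y]|)
    <= P * #|X|.-1.
  rewrite big_distrr big_distrl; apply: leq_sum => y _ /=.
  rewrite big_distrr big_distrl; apply: leq_sum => i _ /=.
  by case: (boolP (sx _ _)) => [/(bad_smallX B)|_]; rewrite /= ?mul0n ?muln0 ?mul1n; lia.
have leQ : #|C| * (\sum_x \sum_i sy i (f i x) * #|[set y | g i y == f i x]|)
    <= Q * #|Y|.-1.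
  rewrite big_distrr big_distrl; apply: leq_sum => x _ /=.
  rewrite big_distrr big_distrl; apply: leq_sum => i _ /=.
  by case: (boolP (sy _ _)) => [/(bad_smallY B)|_]; rewrite /= ?mul0n ?muln0 ?mul1n; lia.
move: le leP leQ eP eQ; set U := \sum_y _; set V := \sum_x _.
set W := (\sum_x _); set Z := \sum_y _.
move=> le leP leQ eP eQ.
have {}le : #|C| * (#|X| * #|Y|) <= P * #|X|.-1 + Q * #|Y|.-1.
  apply: leq_trans (leq_add leP leQ); rewrite -mulnDr leq_mul2l le orbT //.
(* Replacing |X| - 1 and |Y| - 1 by |X| and |Y| is a strict increase only if some pair is
   charged. *)
have PQ0 : 0 < P + Q.
  rewrite lt0n; apply/eqP => PQ; have [P0 Q0] : P = 0 /\ Q = 0 by lia.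
  by move: le; rewrite P0 Q0 leqn0 !muln_eq0; lia.
move: X0 Y0 le eP eQ PQ0 C0.
case: #|X| => // m' _; case: #|Y| => // n' _ /=; move: #|C| => k.
move=> le eP eQ PQ0 C0.
nia.
Qed.

End AnyNumberOfColors.

(** All S(x) and U(y) are nonempty, so the left side of [bad_weight] is at least 2|X||Y|. *)
Lemma bad_three_colors (C X Y T : finType) (f : C -> X -> T) (g : C -> Y -> T)
    sx sy (x0 : X) (y0 : Y) : bad f g sx sy -> 2 < #|C|.
Proof.
move=> B; have X0 : 0 < #|X| by apply/card_gt0P; exists x0.
have Y0 : 0 < #|Y| by apply/card_gt0P; exists y0.
have lX : #|X| <= \sum_x \sum_i sx i (f i x).
  rewrite -sum1_card; apply: leq_sum => x _.
  by have [i e] := bad_small_color B x y0; rewrite (bigD1 i) //= e.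
have lY : #|Y| <= \sum_y \sum_i sy i (g i y).
  rewrite -sum1_card; apply: leq_sum => y _.
  by have [i e] := bad_small_color (bad_sym B) y x0; rewrite (bigD1 i) //= e.
have := bad_weight B x0 y0.
have := leq_mul (leqnn #|Y|) lX; have := leq_mul (leqnn #|X|) lY.
move=> leY leX lt; have {leX leY lt} : 2 * (#|X| * #|Y|) < #|C| * (#|X| * #|Y|) by lia.
by rewrite ltn_mul2r => /andP[].
Qed.

(* The set of colors whose component at [x] is small on the side of [x], as a
   triple of membership bits for the colors [a], [b], [c]. *)
Definition typ (C X T : finType) (f : C -> X -> T) (s : C -> T -> bool) a b c x :=
  (s a (f a x), s b (f b x), s c (f c x)).

Lemma typ12 (C X T : finType) (f : C -> X -> T) s a b c x p q r :
  typ f s a b c x = (p, q, r) -> typ f s b a c x = (q, p, r).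
Proof. by rewrite /typ => -[-> -> ->]. Qed.

Lemma typ13 (C X T : finType) (f : C -> X -> T) s a b c x p q r :
  typ f s a b c x = (p, q, r) -> typ f s c b a x = (r, q, p).
Proof. by rewrite /typ => -[-> -> ->]. Qed.

(** Naming the three colors lets the transpositions [bad3_12], [bad3_13] and the exchange of sides
    [bad3_sym] reduce later cases to one fixed naming. *)
Record bad3 (C X Y T : finType) (f : C -> X -> T) (g : C -> Y -> T)
    (sx sy : C -> T -> bool) (a b c : C) : Prop := Bad3 {
  bad3_bad :> bad f g sx sy;
  bad3_card : #|C| = 3;
  bad3_uniq : uniq [:: a; b; c] }.

Lemma bad3_sym (C X Y T : finType) (f : C -> X -> T) (g : C -> Y -> T) sx sy a b c :
  bad3 f g sx sy a b c -> bad3 g f sy sx a b c.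
Proof. by case=> /bad_sym. Qed.

Lemma bad3_12 (C X Y T : finType) (f : C -> X -> T) (g : C -> Y -> T) sx sy a b c :
  bad3 f g sx sy a b c -> bad3 f g sx sy b a c.
Proof.
case=> B C3 U; split=> //; move: U; rewrite /= !inE !negb_or !andbT.
by rewrite eq_sym => /andP[/andP[-> ->] ->].
Qed.

Lemma bad3_13 (C X Y T : finType) (f : C -> X -> T) (g : C -> Y -> T) sx sy a b c :
  bad3 f g sx sy a b c -> bad3 f g sx sy c b a.
Proof.
case=> B C3 U; split=> //; move: U; rewrite /= !inE !negb_or !andbT.
rewrite [b == a]eq_sym [c == b]eq_sym [c == a]eq_sym.
by move=> /andP[/andP[-> ->] ->].
Qed.

(** * Three colors: edges between given types, and components at singleton types *)

Section ThreeColors.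
Variables (C X Y T : finType) (f : C -> X -> T) (g : C -> Y -> T).
Variables (sx sy : C -> T -> bool) (a b c : C).
Hypothesis B : bad3 f g sx sy a b c.

Local Notation tX := (typ f sx a b c).
Local Notation tY := (typ g sy a b c).

Lemma mem_abc i : [\/ i = a, i = b | i = c].
Proof.
have [_ C3 U] := B; have : i \in [:: a; b; c].
  have /subset_cardP cardP : #|[:: a; b; c]| = #|C| by rewrite C3 (card_uniqP U).
  by rewrite (elimT cardP) //; apply/subsetP.
by rewrite !inE => /or3P[] /eqP ->; [constructor 1|constructor 2|constructor 3].
Qed.

Lemma pair_color x y p q : tX x = p -> tY y = q ->
  [\/ p.1.1 != q.1.1 /\ f a x = g a y, p.1.2 != q.1.2 /\ f b x = g b y
    | p.2 != q.2 /\ f c x = g c y].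
Proof.
move=> <- <-; rewrite /typ /= !(bad_negb B).
have [i e] := bad_cover B x y.
by case: (mem_abc i) e => -> e; [constructor 1|constructor 2|constructor 3];
  rewrite -e; case: (sx _ _).
Qed.

Lemma typ_neq x y p : tX x = p -> tY y = p -> False.
Proof. by move=> hx hy; case: (pair_color hx hy) => -[]; rewrite eqxx. Qed.

Lemma typX_neq0 (y : Y) x : tX x <> (false, false, false).
Proof.
have [i] := bad_small_color B x y; rewrite /typ.
by case: (mem_abc i) => -> -> [].
Qed.

Lemma smallX i t : sy i t = false -> 3 * #|[set x | f i x == t]| < #|X|.
Proof.
by rewrite (bad_negb B) => /negbFE /(bad_smallX B); rewrite (bad3_card B).
Qed.

Lemma smallY i t : sx i t = false -> 3 * #|[set y | g i y == t]| < #|Y|.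
Proof.
move=> s; have : sy i t by rewrite (bad_negb B) s.
by move/(bad_smallY B); rewrite (bad3_card B).
Qed.

(** The components of [x] in colors [b] and [c] are small on the Y side, so they miss more than a
    third of Y. *)
Lemma large_nbr x : tX x = (true, false, false) ->
  #|Y| < 3 * #|[set y | g a y == f a x]|.
Proof.
move=> hx; case: (hx) => _ /smallY hb /smallY hc.
have /card_sub3 : [set: Y] \subset [set y | g a y == f a x]
    :|: [set y | g b y == f b x] :|: [set y | g c y == f c x].
  apply/subsetP => y _; rewrite !inE.
  have [i e] := bad_cover B x y.
  by case: (mem_abc i) e => -> ->; rewrite eqxx ?orbT.
rewrite cardsT; lia.
Qed.

(** Three distinct [a]-components would be disjoint on Y, each with more than a third of it by
    [large_nbr]. *)
Lemma two_labels x1 x2 x3 : tX x1 = (true, false, false) ->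
  tX x2 = (true, false, false) -> tX x3 = (true, false, false) ->
  [\/ f a x1 = f a x2, f a x1 = f a x3 | f a x2 = f a x3].
Proof.
move=> /large_nbr h1 /large_nbr h2 /large_nbr h3.
have [|n12] := eqVneq (f a x1) (f a x2); first by constructor 1.
have [|n13] := eqVneq (f a x1) (f a x3); first by constructor 2.
have [|n23] := eqVneq (f a x2) (f a x3); first by constructor 3.
exfalso; pose N t := [set y | g a y == t].
have dj s t : s != t -> [disjoint N s & N t].
  move=> n; rewrite disjoint_subset; apply/subsetP => y; rewrite !inE => /eqP ->.
  exact: n.
have : #|N (f a x1) :|: N (f a x2) :|: N (f a x3)| <= #|Y| by apply: max_card.
rewrite (_ : #|_| = #|N (f a x1)| + #|N (f a x2)| + #|N (f a x3)|) ?/N; first by lia.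
by rewrite !cardsU setIUl !disjoint_setI0 ?dj // setU0 cards0 !subn0.
Qed.

(* A vertex of [X] outside the color-[a] and color-[c] components of [y] and
   [y'] sends color [b] to both; these components are small on the [X] side, so
   no two of the four coincide. *)
Lemma label_split y y' : tY y = (false, true, false) -> tY y' = (false, true, false) ->
  g b y = g b y' \/ g a y <> g a y' /\ g c y <> g c y'.
Proof.
case=> /smallX ha _ /smallX hc [/smallX ha' _ /smallX hc'].
have [|n] := eqVneq (g b y) (g b y'); first by left.
pose N i t := [set x | f i x == t].
have cov x : [|| x \in N a (g a y), x \in N c (g c y), x \in N a (g a y')
               | x \in N c (g c y')].
  rewrite !inE; have [i] := bad_cover B x y.
  case: (mem_abc i) => -> e; rewrite ?e ?eqxx ?orbT //.
  have [j] := bad_cover B x y'.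
  case: (mem_abc j) => -> e'; rewrite ?e' ?eqxx ?orbT //.
  by rewrite -e -e' eqxx in n.
right; split=> e; have : #|[set: X]| < #|X|; rewrite ?cardsT ?ltnn //.
- have /card_sub3 : [set: X] \subset N a (g a y) :|: N c (g c y) :|: N c (g c y').
    apply/subsetP => x _; have := cov x; rewrite -e !in_setU.
    by case/or4P=> ->; rewrite ?orbT.
  by rewrite cardsT /N; lia.
- have /card_sub3 : [set: X] \subset N a (g a y) :|: N c (g c y) :|: N a (g a y').
    apply/subsetP => x _; have := cov x; rewrite -e !in_setU.
    by case/or4P=> ->; rewrite ?orbT.
  by rewrite cardsT /N; lia.
Qed.

End ThreeColors.

(** * Frequencies of types, using both sides *)

Section ThreeColorsDual.
Variables (C X Y T : finType) (f : C -> X -> T) (g : C -> Y -> T).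
Variables (sx sy : C -> T -> bool) (a b c : C).
Hypothesis B : bad3 f g sx sy a b c.

Local Notation tX := (typ f sx a b c).
Local Notation tY := (typ g sy a b c).

Lemma typY_neq0 (x : X) y : tY y <> (false, false, false).
Proof. exact: typX_neq0 (bad3_sym B) x y. Qed.

(** No vertex y in the [a]-component of [x] has [a] in U(y). If none had U(y) = {b, c}, all would
    have U(y) = {b}, and by [label_split] they would share one [b]-component, which is too small for
    more than a third of Y. *)
Lemma nbr_mixed x : (forall y, tY y <> (false, false, true)) ->
  tX x = (true, false, false) ->
  exists2 y, tY y = (false, true, true) & g a y = f a x.
Proof.
move=> noc hx; have lt := large_nbr B hx.
have sa t : f a x = t -> sy a t = false.
  by move=> <-; case: hx; rewrite (bad_negb B) => ->.
case: (pickP [pred y | (tY y == (false, true, true)) && (g a y == f a x)]).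
  by move=> y /andP[/eqP hy /eqP]; exists y.
move=> no; exfalso.
have typ_nbr y : g a y = f a x -> tY y = (false, true, false).
  move=> e; have := no y; have := noc y; have := @typY_neq0 x y.
  by rewrite /= e eqxx andbT /typ (sa (g a y)) //; case: (sy b _); case: (sy c _).
have /card_gt0P[y] : 0 < #|[set y | g a y == f a x]| by lia.
rewrite inE => /eqP ey; have hy := typ_nbr y ey.
have : 3 * #|[set z | g b z == g b y]| < #|Y|.
  by apply: (smallY B); case: hy; rewrite !(bad_negb B) => _ /negbTE.
have /subset_leq_card : [set y | g a y == f a x] \subset [set z | g b z == g b y].
  apply/subsetP => z; rewrite !inE => /eqP ez.
  have [->//|[]] := label_split B hy (typ_nbr z ez).
  by rewrite ey ez.
lia.
Qed.

(** An [a]-component that is small on the X side cannot hold a third of X. *)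
Lemma labels_differ (x0 : X) : tX x0 = (true, false, false) ->
  #|X| <= 3 * #|[set x | tX x == (true, false, false)]| ->
  exists x x', [/\ tX x = (true, false, false), tX x' = (true, false, false)
                 & f a x <> f a x'].
Proof.
move=> h0 le.
case: (pickP [pred x | (tX x == (true, false, false)) && (f a x != f a x0)]).
  by move=> x /andP[/eqP hx /eqP]; exists x, x0.
move=> no; exfalso.
have : 3 * #|[set x | f a x == f a x0]| < #|X|.
  by apply: (smallX B); case: h0; rewrite (bad_negb B) => ->.
have /subset_leq_card : [set x | tX x == (true, false, false)]
    \subset [set x | f a x == f a x0].
  apply/subsetP => x; rewrite !inE => hx.
  by have := no x; rewrite /= hx => /negbFE.
lia.
Qed.

(** By [two_labels] these vertices occupy at most two [a]-components, each with less than a third of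
    X. *)
Lemma singleton_type_bound (x0 : X) : tX x0 = (true, false, false) ->
  3 * #|[set x | tX x == (true, false, false)]| < 2 * #|X|.
Proof.
move=> h0; have X0 : 0 < #|X| by apply/card_gt0P; exists x0.
have [|le] := ltnP (3 * #|[set x | tX x == (true, false, false)]|) #|X|.
  by lia.
have [x [x' [hx hx' n]]] := labels_differ h0 le.
have : 3 * #|[set z | f a z == f a x]| < #|X|.
  by apply: (smallX B); case: hx; rewrite (bad_negb B) => ->.
have : 3 * #|[set z | f a z == f a x']| < #|X|.
  by apply: (smallX B); case: hx'; rewrite (bad_negb B) => ->.
have /card_sub2 : [set z | tX z == (true, false, false)]
    \subset [set z | f a z == f a x] :|: [set z | f a z == f a x'].
  apply/subsetP => z; rewrite !inE => /eqP hz.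
  by have [//|->|->] := two_labels B hx hx' hz; rewrite eqxx ?orbT.
lia.
Qed.

Definition wt (p : bool * bool * bool) : nat := p.1.1 + p.1.2 + p.2.

Lemma weight_lt (x0 : X) (y0 : Y) :
  #|Y| * (\sum_x wt (tX x)) + #|X| * (\sum_y wt (tY y)) < 3 * #|X| * #|Y|.
Proof.
have [_ C3 U] := B.
have sum3 (F : C -> nat) : \sum_i F i = F a + F b + F c.
  rewrite (eq_bigl (mem [:: a; b; c])) => [|i]; last first.
    by case: (mem_abc B i) => ->; rewrite !inE eqxx ?orbT.
  rewrite -big_uniq //= !big_cons big_nil; lia.
have := bad_weight B x0 y0; rewrite C3.
by under eq_bigr do rewrite sum3; under [X in _ + _ * X]eq_bigr do rewrite sum3.
Qed.

Lemma sum_pred (Z : finType) (P : pred Z) : \sum_z (P z : nat) = #|[set z | P z]|.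
Proof. by rewrite -sum1dep_card [RHS]big_mkcond. Qed.

(** Compare each weight with 2: only the singleton types fall short, by 1, and the full type exceeds
    it by 1. Inserting this into [weight_lt] gives the bound. *)
Lemma weight_bound (x0 : X) (y0 : Y) :
  (forall x, tX x <> (false, true, false)) ->
  (forall y, tY y <> (true, false, false)) ->
  (forall y, tY y <> (false, false, true)) ->
  #|X| * #|Y| + #|X| * #|[set y | tY y == (true, true, true)]| <
  #|Y| * (#|[set x | tX x == (true, false, false)]|
          + #|[set x | tX x == (false, false, true)]|)
  + #|X| * #|[set y | tY y == (false, true, false)]|.
Proof.
move=> nx na nc; have lt := weight_lt x0 y0.
have lX : 2 * #|X| <= \sum_x wt (tX x)
    + #|[set x | tX x == (true, false, false)]|
    + #|[set x | tX x == (false, false, true)]|.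
  rewrite -!sum_pred -!big_split mulnC -sum_nat_const; apply: leq_sum => x _ /=.
  have := nx x; have := typX_neq0 B y0 (x := x).
  by case: (tX x) => -[[] []] [].
have lY : 2 * #|Y| + #|[set y | tY y == (true, true, true)]| <=
    \sum_y wt (tY y) + #|[set y | tY y == (false, true, false)]|.
  rewrite -!sum_pred mulnC -sum_nat_const -!big_split; apply: leq_sum => y _ /=.
  have := na y; have := nc y; have := typY_neq0 x0 (y := y).
  by case: (tY y) => -[[] []] [].
have := leq_mul (leqnn #|Y|) lX; have := leq_mul (leqnn #|X|) lY.
rewrite !mulnDr.
lia.
Qed.

End ThreeColorsDual.

(** * First case: both {a} and {c} occur among the sets S(x) *)

Section CommonNeighbour.
Variables (C X Y T : finType) (f : C -> X -> T) (g : C -> Y -> T).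
Variables (sx sy : C -> T -> bool) (a b c : C).

Local Notation tX := (typ f sx a b c).
Local Notation tY := (typ g sy a b c).

(** Some single y of type {b} is joined in color [c] to every x of type {c}, and its [c]-component
    is small on the X side. *)
Lemma few_c_singletons (B : bad3 f g sx sy a b c) x1 x3 :
  tX x1 = (true, false, false) -> tX x3 = (false, false, true) ->
  3 * #|[set x | tX x == (false, false, true)]| < #|X|.
Proof.
move=> h1 h3; have noc y : tY y <> (false, false, true) by exact: (typ_neq B h3).
have noa y : tY y <> (true, false, false) by exact: (typ_neq B h1).
have [y23 hy23 _] := nbr_mixed B noc h1.
have eb3 x y : tX x = (false, false, true) -> tY y = (false, true, true) ->
    f b x = g b y.
  by move=> hx hy; case: (pair_color B hx hy) => -[].
(* The [a]-component of [x1] has more than a third of Y, the [b]-component of [y23] less; so the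
   former is not contained in the latter on Y. *)
case: (pickP [pred y | (g a y == f a x1) && (g b y != g b y23)]); last first.
  move=> no; exfalso; have := large_nbr B h1.
  have : 3 * #|[set y | g b y == g b y23]| < #|Y|.
    by apply: (smallY B); case: hy23; rewrite !(bad_negb B) => _ /negbTE.
  have /subset_leq_card : [set y | g a y == f a x1] \subset [set y | g b y == g b y23].
    by apply/subsetP => y; rewrite !inE => h; have := no y; rewrite /= h => /negbFE.
  lia.
move=> y /andP[/eqP ea nb].
have hy : tY y = (false, true, false).
  have := noc y; have := @typY_neq0 _ _ _ _ _ _ _ _ _ _ _ B x1 y.
  have n23 : tY y <> (false, true, true).
    by move=> hy; rewrite -(eb3 _ _ h3 hy) (eb3 _ _ h3 hy23) eqxx in nb.
  move: n23; rewrite /typ ea (bad_negb B); case: h1 => -> _ _.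
  by case: (sy b _); case: (sy c _).
have : 3 * #|[set x | f c x == g c y]| < #|X| by apply: (smallX B); case: hy.
apply: leq_ltn_trans; rewrite leq_mul2l /= subset_leq_card //.
apply/subsetP => x; rewrite !inE => /eqP hx.
case: (pair_color B hx hy) => [[]//|[_ e]|[_ ->]//].
by rewrite -e (eb3 _ _ hx hy23) eqxx in nb.
Qed.

End CommonNeighbour.

Section TwoSingletonTypes.
Variables (C X Y T : finType) (f : C -> X -> T) (g : C -> Y -> T).
Variables (sx sy : C -> T -> bool) (a b c : C).

Local Notation tX := (typ f sx a b c).
Local Notation tY := (typ g sy a b c).

Lemma two_singleton_types (B : bad3 f g sx sy a b c) x1 x3 y2 :
  tX x1 = (true, false, false) -> tX x3 = (false, false, true) ->
  tY y2 = (false, true, false) -> False.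
Proof.
move=> h1 h3 h2.
have B13 := bad3_13 B; have D := bad3_sym B; have D12 := bad3_12 D.
have noc y : tY y <> (false, false, true) by exact: (typ_neq B h3).
have noa y : tY y <> (true, false, false) by exact: (typ_neq B h1).
have noX x : tX x <> (false, true, false) by move=> hx; exact: (typ_neq B hx h2).
have [y23 hy23 _] := nbr_mixed B noc h1.
have [y12 /typ13 hy12 _] : exists2 y, typ g sy c b a y = (false, true, true) & g c y = f c x3.
  by apply: (nbr_mixed B13); [move=> y /typ13; exact: noa | exact: typ13].
have eb1 x y : tX x = (true, false, false) -> tY y = (true, true, false) -> f b x = g b y.
  by move=> hx hy; case: (pair_color B hx hy) => -[].
have eb3 x y : tX x = (false, false, true) -> tY y = (false, true, true) -> f b x = g b y.
  by move=> hx hy; case: (pair_color B hx hy) => -[].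
have lt3 := few_c_singletons B h1 h3.
have lt1 : 3 * #|[set x | tX x == (true, false, false)]| < #|X|.
  have := few_c_singletons B13 (typ13 h3) (typ13 h1).
  congr (3 * _ < _); apply: eq_card => x; rewrite !inE.
  by apply/eqP/eqP => /typ13.
(* Types {a} and {c} each take less than a third of X, so [weight_bound] forces this excess of type
   {b} on Y. *)
have lt2 : #|Y| + 3 * #|[set y | tY y == (true, true, true)]|
    < 3 * #|[set y | tY y == (false, true, false)]|.
  have := weight_bound B x1 y2 noX noa noc.
  rewrite ltnNge => lt; rewrite ltnNge; apply: contra lt => le.
  move: lt1 lt3 le; set m := #|X|; set n := #|Y|.
  move: #|[set x | tX x == (true, false, false)]| #|[set x | tX x == (false, false, true)]|
   #|[set y | tY y == (true, true, true)]| #|[set y | tY y == (false, true, false)]|.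
  move=> p q z y lt1 lt3 le.
  have := leq_mul (leqnn m) le; have := leq_mul (leqnn n) (ltnW lt1).
  have := leq_mul (leqnn n) (ltnW lt3).
  rewrite !mulnDr; lia.
have flip y : tY y = (false, true, false) -> typ g sy b a c y = (true, false, false).
  exact: typ12.
have eqS : [set y | tY y == (false, true, false)] =
    [set y | typ g sy b a c y == (true, false, false)].
  by apply/setP => y; rewrite !inE; apply/eqP/eqP => /typ12.
have [y [y' [/typ12 hy /typ12 hy' nyy]]] : exists y y',
    [/\ typ g sy b a c y = (true, false, false),
        typ g sy b a c y' = (true, false, false) & g b y <> g b y'].
  by apply: (labels_differ D12 (flip _ h2)); rewrite -eqS; lia.
have cov z : tY z = (false, true, false) -> g b z = g b y \/ g b z = g b y'.
  move=> /flip hz; have [//|->|->] := two_labels D12 (flip _ hy) (flip _ hy') hz.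
    by left.
  by right.
(* The edges from [x1] to [y] and [y'] have color [a] or [b], not both [a] by [label_split]. A
   [b]-edge puts [x1], hence [y12] by [eb1], in the [b]-component of its end. *)
have c12 : g b y12 = g b y \/ g b y12 = g b y'.
  have [[_ e]|[_ e]|[]//] := pair_color B h1 hy; last by left; rewrite -e -(eb1 _ _ h1 hy12).
  have [[_ e']|[_ e']|[]//] := pair_color B h1 hy'; last by right; rewrite -e' -(eb1 _ _ h1 hy12).
  by have [//|[]] := label_split B hy hy'; rewrite -e -e'.
have c23 : g b y23 = g b y \/ g b y23 = g b y'.
  have [[]//|[_ e]|[_ e]] := pair_color B h3 hy; first by left; rewrite -e -(eb3 _ _ h3 hy23).
  have [[]//|[_ e']|[_ e']] := pair_color B h3 hy'; first by right; rewrite -e' -(eb3 _ _ h3 hy23).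
  by have [//|[]] := label_split B hy hy'; rewrite -e -e'.
(* Otherwise the [b]-components of [y] and [y'], with more than two thirds of X, would contain only
   types {a} and {c}, which make up less. *)
have [x13 hx13] : exists x, tX x = (true, false, true).
  case: (pickP [pred x | tX x == (true, false, true)]) => [x /eqP|no]; first by exists x.
  exfalso.
  have := large_nbr D12 (flip _ hy); have := large_nbr D12 (flip _ hy').
  pose N t := [set x | f b x == t].
  have : #|N (g b y) :|: N (g b y')| = #|N (g b y)| + #|N (g b y')|.
    rewrite cardsU disjoint_setI0 ?cards0 ?subn0 // disjoint_subset.
    by apply/subsetP => x; rewrite !inE => /eqP ->; apply/eqP.
  have /card_sub2 : N (g b y) :|: N (g b y') \subset
      [set x | tX x == (true, false, false)] :|: [set x | tX x == (false, false, true)].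
    apply/subsetP => x; rewrite !inE => hN.
    have sb : sx b (f b x) = false.
      have sy' z : tY z = (false, true, false) -> sx b (g b z) = false.
        by case; rewrite !(bad_negb B) => _ /negbTE.
      by case/orP: hN => /eqP ->; exact: sy'.
    have := no x; have := @typX_neq0 _ _ _ _ _ _ _ _ _ _ _ B y2 x.
    by rewrite /= /typ sb; case: (sx a _); case: (sx c _).
  rewrite /N; lia.
have smb z : tY z = (false, true, false) -> 3 * #|[set y | g b y == g b z]| < #|Y|.
  by move=> hz; apply: (smallY B); case: hz; rewrite !(bad_negb B) => _ /negbTE.
(* [x13] excludes type {a, c} on Y, so all types but {a, b, c} lie in two small [b]-components. Thus
   {a, b, c} takes more than a third of Y, and by [lt2] type {b} more than two thirds, against
   [singleton_type_bound]. *)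
have := smb y hy; have := smb y' hy'.
have := singleton_type_bound D12 (flip _ h2); rewrite -eqS.
have /card_sub3 : [set: Y] \subset [set z | g b z == g b y] :|: [set z | g b z == g b y']
    :|: [set z | tY z == (true, true, true)].
  apply/subsetP => z _; rewrite !inE.
  case E : (tY z) (noc z) (noa z) (@typY_neq0 _ _ _ _ _ _ _ _ _ _ _ B x1 z) =>
    [[[] []] []] //= _ _ _; rewrite ?orbT ?orbF //.
  - rewrite -(eb1 _ _ h1 E) (eb1 _ _ h1 hy12).
    by case: c12 => ->; rewrite eqxx ?orbT.
  - by case: (typ_neq B hx13 E).
  - rewrite -(eb3 _ _ h3 E) (eb3 _ _ h3 hy23).
    by case: c23 => ->; rewrite eqxx ?orbT.
  - by case: (cov z E) => ->; rewrite eqxx ?orbT.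
rewrite cardsT; lia.
Qed.

End TwoSingletonTypes.

(** * Second case: {c} occurs on neither side *)

Section ThirdLabel.
Variables (C X Y T : finType) (f : C -> X -> T) (g : C -> Y -> T).
Variables (sx sy : C -> T -> bool) (a b c : C).

Local Notation tX := (typ f sx a b c).
Local Notation tY := (typ g sy a b c).

(** The [a]-components of [x] and [x'] cover less than two thirds of X. Any vertex outside them has
    type {a, c}: each other type is excluded by its edges to [y2], [y2'] and a vertex of type {b,
    c}, by [two_labels], or by hypothesis. *)
Lemma third_label (B : bad3 f g sx sy a b c) x x' y2 y2' :
  (forall x, tX x <> (false, false, true)) ->
  (forall y, tY y <> (false, false, true)) ->
  tX x = (true, false, false) -> tX x' = (true, false, false) ->
  f a x <> f a x' -> tY y2 = (false, true, false) ->
  tY y2' = (false, true, false) -> g b y2 <> g b y2' ->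
  exists2 z, tX z = (true, false, true) & f a z <> f a x /\ f a z <> f a x'.
Proof.
move=> ncX ncY hx hx' nx hy hy' ny.
have [y hy23 ey] := nbr_mixed B ncY hx.
have small z : tX z = (true, false, false) -> 3 * #|[set w | f a w == f a z]| < #|X|.
  by move=> hz; apply: (smallX B); case: hz; rewrite (bad_negb B) => ->.
case: (pickP [pred z | (f a z != f a x) && (f a z != f a x')]); last first.
  move=> no; exfalso; have := small x hx; have := small x' hx'.
  have /card_sub2 : [set: X] \subset [set w | f a w == f a x] :|: [set w | f a w == f a x'].
    by apply/subsetP => z _; rewrite !inE; have := no z; rewrite /=; do 2 case: eqP.
  rewrite cardsT; lia.
move=> z /andP[/eqP n /eqP n']; exists z => //.
case E : (tX z) (ncX z) (@typX_neq0 _ _ _ _ _ _ _ _ _ _ _ B y z) => [[[] []] []] // _ _.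
- by have [[_ e]|[]//|[]//] := pair_color B E hy23; case: n; rewrite e.
- exfalso; have [[_ e]|[]//|[]//] := pair_color B E hy.
  have [[_ e']|[]//|[]//] := pair_color B E hy'.
  by have [//|[]] := label_split B hy hy'; rewrite -e -e'.
- by have [//|/esym|/esym] := two_labels B hx hx' E.
- by case: (typ_neq B E hy23).
- by case: (typ_neq B E hy).
Qed.

End ThirdLabel.

Lemma one_singleton_type (C X Y T : finType) (f : C -> X -> T) (g : C -> Y -> T)
    sx sy a b c (B : bad3 f g sx sy a b c) x1 y2 :
  typ f sx a b c x1 = (true, false, false) ->
  typ g sy a b c y2 = (false, true, false) ->
  (forall x, typ f sx a b c x <> (false, false, true)) ->
  (forall y, typ g sy a b c y <> (false, false, true)) -> False.
Proof.
move=> h1 h2 ncX ncY.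
have D := bad3_sym B; have D12 := bad3_12 D.
have h2' := typ12 h2.
have naY y : typ g sy a b c y <> (true, false, false) by exact: (typ_neq B h1).
have nbX x : typ f sx a b c x <> (false, true, false).
  by move=> hx; exact: (typ_neq B hx h2).
have ncX' x : typ f sx b a c x <> (false, false, true) by move/typ12; exact: ncX.
have ncY' y : typ g sy b a c y <> (false, false, true) by move/typ12; exact: ncY.
have eqS : [set y | typ g sy a b c y == (false, true, false)] =
    [set y | typ g sy b a c y == (true, false, false)].
  by apply/setP => y; rewrite !inE; apply/eqP/eqP => /typ12.
have lt := weight_bound B x1 y2 nbX naY ncY.
have lt1 := singleton_type_bound B h1.
have lt2 := singleton_type_bound D12 h2'.
have x30 : #|[set x | typ f sx a b c x == (false, false, true)]| = 0.
  by apply: eq_card0 => x; rewrite !inE; apply/eqP/ncX.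
rewrite x30 addn0 eqS in lt.
have X0 : 0 < #|X| by apply/card_gt0P; exists x1.
have Y0 : 0 < #|Y| by apply/card_gt0P; exists y2.
(* In [weight_bound] the fractions of type {a} in X and of type {b} in Y add up to more than 1; each
   is below 2/3, so each is above 1/3. *)
have [le1 le2] : #|X| <= 3 * #|[set x | typ f sx a b c x == (true, false, false)]| /\
    #|Y| <= 3 * #|[set y | typ g sy b a c y == (true, false, false)]|.
  move: lt lt1 lt2 X0 Y0; move: #|X| #|Y| #|[set x | typ f sx a b c x == _]|
    #|[set y | typ g sy b a c y == _]| #|_| => m n p q z lt lt1 lt2 m0 n0.
  have := leq_mul (leqnn n) (ltnW lt1); have := leq_mul (leqnn m) (ltnW lt2).
  split; rewrite leqNgt; apply/negP => h.
    have := leq_mul (leqnn n) (ltnW h); lia.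
  have := leq_mul (leqnn m) (ltnW h); lia.
have [x [x' [hx hx' nx]]] := labels_differ B h1 le1.
have [y [y' [/typ12 hy /typ12 hy' ny]]] := labels_differ D12 h2' le2.
have [z hz [n n']] := third_label B ncX ncY hx hx' nx hy hy' ny.
have [w /typ12 hw [k k']] :=
  third_label D12 ncY' ncX' (typ12 hy) (typ12 hy') ny (typ12 hx) (typ12 hx') nx.
have [u hu eu] := nbr_mixed B ncY hx.
have [u' hu' eu'] := nbr_mixed B ncY hx'.
have [v /typ12 hv ev] := nbr_mixed D12 ncX' (typ12 hy).
have [v' /typ12 hv' ev'] := nbr_mixed D12 ncX' (typ12 hy').
(* Types {a, c} and {b, c} are joined only in colors [a] and [b]. Since [z] avoids the
   [a]-components of [u] and [u'], it is joined to both in color [b]. Dually [w] is joined to [v]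
   and [v'] in color [a]. *)
have [[_ e]|[_ e]|[]//] := pair_color B hz hu; first by case: n; rewrite e.
have [[_ e']|[_ e']|[]//] := pair_color B hz hu'; first by case: n'; rewrite e'.
have [[_ d]|[_ d]|[]//] := pair_color B hv hw; last by case: k; rewrite -d.
have [[_ d']|[_ d']|[]//] := pair_color B hv' hw; last by case: k'; rewrite -d'.
(* As [u] and [u'] differ in [a]-component, each of [v], [v'] sends color [b] to one of them. Both
   then lie in the common [b]-component of [u] and [u'], contradicting [ny]. *)
have [[_ r1]|[_ r1]|[]//] := pair_color B hv hu;
have [[_ r2]|[_ r2]|[]//] := pair_color B hv hu';
have [[_ r3]|[_ r3]|[]//] := pair_color B hv' hu;
have [[_ r4]|[_ r4]|[]//] := pair_color B hv' hu'; congruence.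
Qed.


(** * Reduction to the two cases and the statement for labels *)

Lemma singleton_type_exists (C X Y T : finType) (f : C -> X -> T) (g : C -> Y -> T)
    sx sy a b c (B : bad3 f g sx sy a b c) (x0 : X) (y0 : Y) :
  exists x, wt (typ f sx a b c x) = 1.
Proof.
case: (pickP [pred x | wt (typ f sx a b c x) == 1]) => [x /eqP|no]; first by exists x.
exfalso; have lt := weight_lt B x0 y0.
(* Weights at least 2 on X and at least 1 on Y already reach the bound 3|X||Y| of [weight_lt]. *)
have leX : #|X| * 2 <= \sum_x wt (typ f sx a b c x).
  rewrite -sum_nat_const; apply: leq_sum => x _.
  have := no x; have := typX_neq0 B y0 (x := x).
  by rewrite /=; case: (typ f sx a b c x) => -[[] []] [].
have leY : #|Y| * 1 <= \sum_y wt (typ g sy a b c y).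
  rewrite -sum_nat_const; apply: leq_sum => y _.
  have := typY_neq0 B x0 (y := y).
  by rewrite /=; case: (typ g sy a b c y) => -[[] []] [].
have := leq_mul (leqnn #|Y|) leX; have := leq_mul (leqnn #|X|) leY; lia.
Qed.

Lemma bad3_singletons (C X Y T : finType) (f : C -> X -> T) (g : C -> Y -> T)
    sx sy a b c (B : bad3 f g sx sy a b c) x y :
  typ f sx a b c x = (true, false, false) ->
  typ g sy a b c y = (false, true, false) -> False.
Proof.
move=> hx hy.
case: (pickP [pred x | typ f sx a b c x == (false, false, true)]) => [x3 /eqP h3|ncX].
  exact: (two_singleton_types B hx h3 hy).
case: (pickP [pred y | typ g sy a b c y == (false, false, true)]) => [y3 /eqP h3|ncY].
  exact: (two_singleton_types (bad3_12 (bad3_sym B)) (typ12 hy) (typ12 h3) (typ12 hx)).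
by apply: (one_singleton_type B hx hy) => z h; [have := ncX z|have := ncY z]; rewrite /= h.
Qed.

Lemma bad3_false (C X Y T : finType) (f : C -> X -> T) (g : C -> Y -> T)
    sx sy a b c (B : bad3 f g sx sy a b c) (x0 : X) (y0 : Y) : False.
Proof.
have [x] := singleton_type_exists B x0 y0.
wlog hx : a b c B / typ f sx a b c x = (true, false, false).
  move=> IH; case E : (typ f sx a b c x) => [[[] []] []] //= _.
  - by apply: (IH _ _ _ B E); rewrite E.
  - by apply: (IH _ _ _ (bad3_12 B) (typ12 E)); rewrite (typ12 E).
  - by apply: (IH _ _ _ (bad3_13 B) (typ13 E)); rewrite (typ13 E).
move=> _; have [y] := singleton_type_exists (bad3_sym B) y0 x0.
case E : (typ g sy a b c y) => [[[] []] []] //= _.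
- exact: (typ_neq B hx E).
- exact: (bad3_singletons B hx E).
(* The three transpositions compose to the exchange of [b] and [c]. *)
- exact: (bad3_singletons (bad3_12 (bad3_13 (bad3_12 B)))
    (typ12 (typ13 (typ12 hx))) (typ12 (typ13 (typ12 E)))).
Qed.

Lemma large_label (C X Y T : finType) (f : C -> X -> T) (g : C -> Y -> T)
    (x0 : X) (y0 : Y) : #|C| <= 3 -> (forall x y, exists i, f i x = g i y) ->
  exists i t, #|X| <= #|C| * #|[set x | f i x == t]| /\
    #|Y| <= #|C| * #|[set y | g i y == t]|.
Proof.
move=> C3 cov.
case: (pickP [pred it : C * T | (#|X| <= #|C| * #|[set x | f it.1 x == it.2]|) &&
    (#|Y| <= #|C| * #|[set y | g it.1 y == it.2]|)]) => [[i t] /andP[]|no].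
  by exists i, t.
(* Labels small on both sides are marked on the X side only, which makes the two marks
   complementary. *)
exfalso; pose sx i t := #|C| * #|[set x | f i x == t]| < #|X|.
have B : bad f g sx (fun i t => ~~ sx i t).
  split=> // i t; rewrite /sx -leqNgt => le.
  by have := no (i, t); rewrite /= le /= ltnNge => ->.
have {}C3 : #|C| = 3 by apply/eqP; rewrite eqn_leq C3 (bad_three_colors x0 y0 B).
have := enum_uniq C; have : size (enum C) = 3 by rewrite -cardE.
case: (enum C) => [|a [|b [|c []]]] // _ U.
exact: (bad3_false (Bad3 B C3 U) x0 y0).
Qed.

(** * Monochromatic components as labels *)

Lemma color_adj_sym (V : finType) (e : rel V) r (c : edge_coloring e r) i :
  symmetric (color_adj c i).
Proof. by move=> u v; apply: eq_existsb => E; rewrite setUC. Qed.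

Lemma color_adj_exists (V : finType) (e : rel V) r (c : edge_coloring e r) u v :
  e u v -> exists i, color_adj c i u v.
Proof.
move=> euv; have Ein : [set u; v] \in edge_set e.
  by apply/imsetP; exists (u, v); rewrite // inE.
exists (c (Sub [set u; v] Ein)); apply/existsP; exists (Sub [set u; v] Ein).
by rewrite SubK !eqxx.
Qed.

Lemma component_eq (V : finType) (e : rel V) : symmetric e -> forall u v,
  ([set w | connect e u w] == [set w | connect e v w]) = connect e v u.
Proof.
move=> /sym_connect_sym cs u v; apply/eqP/idP => [/setP/(_ u)|vu].
  by rewrite !inE connect0.
by apply/setP => w; rewrite !inE (same_connect cs vu).
Qed.

Local Open Scope ring_scope.

Theorem theorem3 (r m n : nat) (hr1 : (1 <= r)%N) (hr3 : (r <= 3)%N)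
    (hm : (0 < m)%N) (hn : (0 < n)%N)
    (X Y : finType) (hX : #|X| = m) (hY : #|Y| = n)
    (c : edge_coloring (Kmn X Y) r) :
  exists (i : 'I_r) (H : {set X + Y}),
    [/\ is_component (color_adj c i) H,
        (m%:R / r%:R : rat) <= #|H :&: classX X Y|%:R
      & (n%:R / r%:R : rat) <= #|H :&: classY X Y|%:R].
Proof.
have [x0 _] : exists x : X, x \in X by apply/card_gt0P; rewrite hX.
have [y0 _] : exists y : Y, y \in Y by apply/card_gt0P; rewrite hY.
(* The label of a component is its own vertex set. *)
pose comp i v := [set w | connect (color_adj c i) v w].
have cov x y : exists i : 'I_r, comp i (inl x) = comp i (inr y).
  have [i adj] := color_adj_exists c (isT : Kmn X Y (inr y) (inl x)).
  exists i; apply/eqP; rewrite component_eq; last exact: color_adj_sym.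
  exact: connect1.
have r3 : (#|'I_r| <= 3)%N by rewrite card_ord.
have [i [H []]] := large_label x0 y0 r3 cov.
rewrite card_ord hX hY => leX leY.
(* A priori [H] is an arbitrary set; as m > 0, [leX] gives a vertex of X whose component is [H]. *)
have [v eH] : is_component (color_adj c i) H.
  have /card_gt0P[x] : (0 < #|[set x | comp i (inl x) == H]|)%N.
    by rewrite lt0n; apply: contraTneq leX => ->; rewrite muln0 -ltnNge.
  by rewrite inE => /eqP <-; exists (inl x).
have r0 : 0 < r%:R :> rat by rewrite ltr0n.
exists i, H; split; first by exists v.
- rewrite ler_pdivrMr // -natrM ler_nat mulnC (leq_trans leX) // leq_mul2l.
  rewrite -(card_imset _ (@inl_inj X Y)) subset_leq_card ?orbT //.
  apply/subsetP => _ /imsetP[x + ->]; rewrite !inE imset_f // andbT => /eqP <-.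
  by rewrite inE connect0.
- rewrite ler_pdivrMr // -natrM ler_nat mulnC (leq_trans leY) // leq_mul2l.
  rewrite -(card_imset _ (@inr_inj X Y)) subset_leq_card ?orbT //.
  apply/subsetP => _ /imsetP[y + ->]; rewrite !inE imset_f // andbT => /eqP <-.
  by rewrite inE connect0.
Qed.
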